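(* Let $d\ge1$, $1<\alpha<2$, $T>0$, $x_0\in\mathbb{R}^d$, and let $L^\alpha_t$ be a $d$-dimensional symmetric $\alpha$-stable Lévy motion. Let $f:\mathbb{R}^d\to\mathbb{R}^d$ be Lipschitz continuous, $g(x_0)\in\mathbb{R}$ a constant, and $Y$ the solution of $$Y(t)=x_0+\int_0^t f(Y(s))\,ds+g(x_0)L^\alpha_t,\qquad t\in[0,T].$$ For $m\in\mathbb{N}^+$ let $f_m:\mathbb{R}^d\to\mathbb{R}^d$ (e.g. two-layer neural networks of width $m$) and constants $g_m(x_0)\in\mathbb{R}$ satisfy: (i) there is $K>0$ with $|f_m(x_1)-f_m(x_2)|\le K|x_1-x_2|$ for all $x_1,x_2\in\mathbb{R}^d$ and all $m$; (ii) $\|f_m-f\|_{L^2(D)}\to0$ as $m\to\infty$ for every compact $D\subset\mathbb{R}^d$, and $g_m(x_0)\to g(x_0)$. For $\Delta t\in(0,1)$ with $T/\Delta t\in\mathbb{N}$, let $X^{(m)}=X^{(m,\Delta t)}$ be the continuous-time Euler–Maruyama process $$X^{(m)}(t)=x_0+\int_0^t f_m(\overline{X^{(m)}}(s))\,ds+g_m(x_0)L^\alpha_t,\qquad t\in[0,T],$$ where $\overline{X^{(m)}}(t)=X^{(m)}(k\Delta t)$ for $t\in[k\Delta t,(k+1)\Delta t)$. Then $X^{(m)}\to Y$ in probability with respect to the Skorokhod distance $d_T$ on $\mathbb{D}_{\mathbb{R}^d}[0,T]$, in the sense that for every $\delta>0$, $$\mathbb{P}\big(d_T(Y,X^{(m,\Delta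 t)})>\delta\big)\to0\quad\text{as } m\to\infty\text{ and }\Delta t\to0.$$
   Context: A symmetric $\alpha$-stable Lévy motion $L^\alpha_t$ ($0<\alpha<2$) is a process with $L^\alpha_0=0$ a.s., independent increments, $L^\alpha_t-L^\alpha_s\sim S_\alpha((t-s)^{1/\alpha},0,0)$ for $s<t$, and stochastically continuous paths. The diffusion coefficient $g_m(x_0)$ is interpreted as the $d\times d$ diagonal matrix $g_m(x_0)I_d$ (likewise for $g(x_0)$). $\mathbb{D}_{\mathbb{R}^d}[0,T]$ is the Skorokhod space of càdlàg functions $[0,T]\to\mathbb{R}^d$ with the Skorokhod metric $d_T$. $L^2(D)$ is with respect to Lebesgue measure; $|\cdot|$ is the Euclidean norm. *)

(* Defs.v *)
From HB Require Import structures.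
From mathcomp Require Import all_boot all_order all_algebra.
From mathcomp Require Import all_classical all_reals all_analysis.

Set Implicit Arguments.
Unset Strict Implicit.
Unset Printing Implicit Defensive.

Import Order.TTheory GRing.Theory Num.Theory.
Import numFieldNormedType.Exports.

Local Open Scope classical_set_scope.
Local Open Scope ring_scope.

Section Defs.
Variable R : realType.

Definition enorm (d : nat) (v : 'rV[R]_d) : R :=
  Num.sqrt (\sum_(i < d) (v 0 i) ^+ 2).

Definition lipschitz_with (d : nat) (K : R) (h : 'rV[R]_d -> 'rV[R]_d) :=
  forall x1 x2, enorm (h x1 - h x2) <= K * enorm (x1 - x2).

(** Lebesgue integral on R^d of a nonnegative function, as the iterated
    one-dimensional Lebesgue integral (Tonelli). *)
Fixpoint leb_int (n : nat) : ('rV[R]_n -> \bar R) -> \bar R :=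
  match n with
  | 0 => fun h => h 0
  | n'.+1 => fun h =>
      (\int[@lebesgue_measure R]_(a in setT)
          leb_int (fun y : 'rV[R]_n' => h (row_mx (const_mx a : 'rV[R]_1) y)))%E
  end.

Definition L2dist2 (d : nat) (D : set 'rV[R]_d) (h1 h2 : 'rV[R]_d -> 'rV[R]_d)
  : \bar R :=
  leb_int (fun x => ((\1_D x : R) * enorm (h1 x - h2 x) ^+ 2)%:E).

Definition borel_sets (T : topologicalType) : set (set T) :=
  <<s [set A : set T | open A] >>.

Section Prob.
Context (d0 : measure_display) (Omega : measurableType d0)
        (P : probability Omega R).

Definition mutually_indep (T : topologicalType) (n : nat)
    (X : 'I_n -> Omega -> T) :=
  forall B : 'I_n -> set T, (forall k, borel_sets (B k)) ->
    P (\bigcap_(k in [set: 'I_n]) (X k @^-1` B k)) =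
    (\prod_(k < n) fine (P (X k @^-1` B k)))%:E.

Definition Pout (A : set Omega) : \bar R :=
  ereal_inf [set P B | B in [set B | measurable B /\ A `<=` B]].

(** A real random variable with symmetric alpha-stable law S_alpha(sigma,0,0),
    i.e. characteristic function  E[exp(i u Z)] = exp(- sigma^alpha |u|^alpha). *)
Definition sym_stable (alpha sigma : R) (Z : Omega -> R) :=
  measurable_fun setT Z /\
  forall u : R,
    (\int[P]_w (cos (u * Z w))%:E)%E = (expR (- (sigma `^ alpha * `|u| `^ alpha)))%:E /\
    (\int[P]_w (sin (u * Z w))%:E)%E = 0%E.

Definition sym_stable_levy (d : nat) (alpha : R) (L : Omega -> R -> 'rV[R]_d) :=
  (forall t i, measurable_fun setT (fun w => L w t 0 i)) /\
  P [set w | L w 0 = 0] = 1%E /\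
  (forall (n : nat) (tt : nat -> R), 0 <= tt 0%N ->
     (forall k, (k < n)%N -> tt k < tt k.+1) ->
     mutually_indep (fun (k : 'I_n) w => L w (tt k.+1) - L w (tt k))) /\
  (forall s t, 0 <= s -> s < t ->
     mutually_indep (fun (i : 'I_d) w => L w t 0 i - L w s 0 i) /\
     forall i : 'I_d,
       sym_stable alpha ((t - s) `^ alpha^-1) (fun w => L w t 0 i - L w s 0 i)) /\
  (forall s, 0 <= s -> forall eps eta : R, 0 < eps -> 0 < eta ->
     exists r : R, 0 < r /\ forall t, 0 <= t -> `|t - s| < r ->
       (P [set w | (eps < enorm (L w t - L w s))%R] < eta%:E)%E).

End Prob.

Definition cadlag_on (d : nat) (T : R) (x : R -> 'rV[R]_d) :=
  (forall t, 0 <= t < T -> x @ at_right t --> x t) /\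
  (forall t, 0 < t <= T -> cvg (x @ at_left t)).

Definition time_changes (T : R) : set (R -> R) :=
  [set lam : R -> R | {within `[0, T], continuous lam} /\
             {in `[0, T] &, forall s t, s < t -> lam s < lam t} /\
             lam 0 = 0 /\ lam T = T].

Definition skorokhod_dist (d : nat) (T : R) (x y : R -> 'rV[R]_d) : \bar R :=
  ereal_inf [set Order.max
                (ereal_sup [set (`|lam t - t|)%:E | t in `[0, T]])
                (ereal_sup [set (enorm (x t - y (lam t)))%:E | t in `[0, T]])
            | lam in time_changes T].

End Defs.

(* Main.v *)
(** The noise is additive, so [W := (Y - g L) - (X - g_m L)] is an integral and no
    stochastic calculus is needed: the argument is pathwise, and of [L] it uses only that it
    is cadlag with measurable marginals. On each cell of the mesh, [W] grows by at most
    [K dt |W|] plus an error made of the oscillation of [L] on the cell, of [dt], of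
    [|f_m - f|] on the range of [Y], and of [|g_m - g|]; a discrete Gronwall inequality
    bounds [W] uniformly.
    - A cadlag path has only finitely many jumps larger than a given size, so the mean over
      the cells of its oscillations tends to 0; these means and the supremum of [|L|] are
      random variables, hence are controlled off a measurable event of small probability.
    - Functions with a common Lipschitz constant that converge in L^2 on compact sets
      converge locally uniformly.
    - The Skorokhod distance is at most the uniform distance. *)
Require Import Defs.
From HB Require Import structures.
From mathcomp Require Import all_boot all_order all_algebra.
From mathcomp Require Import all_classical all_reals all_analysis.
From mathcomp Require Import measurable_realfun ring lra.
Import Order.TTheory GRing.Theory Num.Theory.
Import numFieldNormedType.Exports.
Local Open Scope classical_set_scope.
Local Open Scope ring_scope.

Set Implicit Arguments.
Unset Strict Implicit.
Unset Printing Implicit Defensive.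

(** * Norms on row vectors *)

Section Norms.
Variables (R : realType) (d : nat).
Implicit Types v : 'rV[R]_d.

Lemma row_norm_le v (c : R) : 0 <= c -> (forall i, `|v 0 i| <= c) -> `|v| <= c.
Proof.
move=> c0 H; rewrite [leLHS]/Num.Def.normr/= mx_normrE (bigmax_le _ c0)//= => -[i j] _ /=.
by rewrite (ord1 i).
Qed.

Lemma coord_le_norm v i : `|v 0 i| <= `|v|.
Proof.
rewrite [leRHS]/Num.Def.normr/= mx_normrE.
exact: (le_bigmax _ (fun ij : 'I_1 * 'I_d => `|v ij.1 ij.2|) (0, i)).
Qed.

Lemma norm_le_enorm v : `|v| <= enorm v.
Proof.
apply: row_norm_le => [|i]; first exact: sqrtr_ge0.
rewrite -sqrtr_sqr ler_wsqrtr// (bigD1 i)//= lerDl sumr_ge0// => j _.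
exact: sqr_ge0.
Qed.

Lemma enorm_le_norm v : enorm v <= d%:R * `|v|.
Proof.
have n0 : 0 <= d%:R * `|v| by rewrite mulr_ge0.
rewrite -(ger0_norm n0) -sqrtr_sqr ler_wsqrtr//.
apply: (@le_trans _ _ (\sum_(i < d) `|v| ^+ 2)).
  apply: ler_sum => i _; rewrite -real_normK ?num_real// lerXn2r ?nnegrE//.
  exact: coord_le_norm.
rewrite sumr_const card_ord exprMn -[leLHS]mulr_natl ler_wpM2r ?sqr_ge0//.
rewrite -natrX ler_nat; case: (d) => // n.
by rewrite leq_pmulr.
Qed.

(** The estimates run in the sup norm [|v|], where vector integrals are bounded coordinate by
    coordinate; the factor [d] is the price of leaving [enorm]. *)
Lemma lipschitz_norm (K : R) (h : 'rV[R]_d -> 'rV[R]_d) :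
  0 <= K -> lipschitz_with K h ->
  forall x y, `|h x - h y| <= K * d%:R * `|x - y|.
Proof.
move=> K0 Kh x y; apply: (le_trans (norm_le_enorm _)).
apply: (le_trans (Kh x y)).
by rewrite -mulrA ler_wpM2l// enorm_le_norm.
Qed.

End Norms.

(** * Integrals *)

Section Integrals.
Variable R : realType.
Local Notation mu := (@lebesgue_measure R).

Lemma itv_cc_finite (a b : R) : (mu `[a, b] < +oo)%E.
Proof. by rewrite lebesgue_measure_itv/=; case: ifP => // _; rewrite -EFinD ltry. Qed.

Lemma floor_cell (dt s : R) (k : nat) : 0 < dt ->
  k%:R * dt <= s < k.+1%:R * dt -> Num.floor (s / dt) = k.
Proof.
move=> dt0 /andP[ks sk]; apply: floor_def.
by rewrite ler_pdivlMr// ltr_pdivrMr// -natr1 in sk *; rewrite ks intrD.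
Qed.

Lemma measurable_step (h : int -> R) (dt : R) (N : nat) : 0 < dt ->
  measurable_fun `[0, N%:R * dt[ (fun s => h (Num.floor (s / dt))).
Proof.
move=> dt0; elim: N => [|N IH].
  by rewrite mul0r set_itvco0; exact: measurable_fun_set0.
have -> : `[0, N.+1%:R * dt[%classic =
    `[0, N%:R * dt[%classic `|` `[N%:R * dt, N.+1%:R * dt[%classic.
  rewrite -itv_bndbnd_setU// bnd_simp ?mulr_ge0 ?ler_wpM2r ?ler_nat// ltW//.
apply/measurable_funU => //; split => //.
apply: (@eq_measurable_fun _ _ _ _ _ (cst (h N))) => [s|]; last exact: measurable_cst.
by rewrite inE/= in_itv/= => /(floor_cell dt0) ->.
Qed.

(** The Euler drift freezes the state at the last mesh point, hence takes finitely many values on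
    [[0, T]]: its integrability is proved rather than assumed. *)
Lemma integrable_step (h : int -> R) (dt : R) (N : nat) : 0 < dt ->
  mu.-integrable `[0, N%:R * dt] (fun s => (h (Num.floor (s / dt)))%:E).
Proof.
move=> dt0; apply: (@measurable_bounded_integrable _ _ _ mu
  (fun s => h (Num.floor (s / dt)))) => //; first exact: itv_cc_finite.
(* The closed interval reaches into cell number [N], hence [N.+1] half-open cells. *)
- apply: (measurable_funS _ _ (@measurable_step h _ N.+1 dt0)) => //.
  move=> s /=; rewrite !in_itv/= => /andP[-> /le_lt_trans]; apply.
  by rewrite ltr_pM2r// ltr_nat.
- exists (\sum_(k < N.+1) `|h k|); split; first exact: num_real.
  move=> M ltM s /=; rewrite in_itv/= => /andP[s0 sN].
  apply: le_trans (ltW ltM).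
  have /andP[f1 f2] := floor_itv (s / dt).
  have f0 : 0 <= Num.floor (s / dt) by rewrite floor_ge0 divr_ge0// ltW.
  have fN : Num.floor (s / dt) < N.+1.
    by rewrite floor_lt_int (@le_lt_trans _ _ N%:R)// ?ler_pdivrMr// ltr_nat.
  move: f0 fN; case: (Num.floor _) => // k _ kN.
  by rewrite (bigD1 (Ordinal kN))//= lerDl sumr_ge0.
Qed.

(** [c0] stands for a frozen value of the drift. The right end is left out of the bound because the
    Euler drift may jump there; endpoints are null, so everything is integrated over []a, b[]. *)
Lemma integral_increment (h : R -> R) (T a b c0 c : R) :
  mu.-integrable `[0, T] (EFin \o h) -> 0 <= a -> a <= b -> b <= T ->
  (forall s, a <= s < b -> `|h s - c0| <= c) ->
  `|\int[mu]_(s in `[0, b]) h s - \int[mu]_(s in `[0, a]) h s - (b - a) * c0|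
    <= (b - a) * c.
Proof.
move=> ih a0 ab bT hc.
have ihb : mu.-integrable `[0, b] (EFin \o h).
  apply: integrableS ih => // s /=; rewrite !in_itv/= => /andP[-> sb].
  exact: le_trans bT.
have ih_ab : mu.-integrable `]a, b[ (EFin \o h).
  apply: integrableS ihb => // s /=; rewrite !in_itv/= => /andP[as_ /ltW ->].
  by rewrite (le_trans a0 (ltW as_)).
have icst (r : R) : mu.-integrable `]a, b[ (EFin \o cst r).
  have : mu.-integrable `[a, b] (EFin \o cst r).
    apply: measurable_bounded_integrable => //; first exact: itv_cc_finite.
    by exists `|r|; split; [exact: num_real|move=> x xr y _; exact: ltW].
  by apply: integrableS => // s /=; rewrite !in_itv/= => /andP[/ltW -> /ltW ->].
rewrite Rintegral_itvB ?bnd_simp//.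
rewrite -Rintegral_itv_bndo_bndc//.
have Icst (r : R) : \int[mu]_(s in `]a, b[) r = (b - a) * r.
  have muE : fine (mu `]a, b[) = b - a.
    rewrite lebesgue_measure_itv/= lte_fin.
    by move: ab; rewrite le_eqVlt => /predU1P[->|->//]; rewrite ltxx subrr.
  by rewrite Rintegral_cst// [fine _]muE mulrC.
have ihc : mu.-integrable `]a, b[ (EFin \o (fun s => h s - c0)).
  have := integrableB _ ih_ab (icst c0).
  by apply.
rewrite -(Icst c0) -RintegralB//; last exact: icst.
apply: le_trans (le_normr_Rintegral _ ihc) _ => //.
rewrite -(Icst c); apply: le_Rintegral => //.
- exact: (integrable_norm ihc).
- exact: icst.
by move=> s /=; rewrite in_itv/= => /andP[/ltW as_ sb]; apply: hc; rewrite as_ sb.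
Qed.

End Integrals.

(** * Cadlag paths *)

Section Cadlag.
Variables (R : realType) (d : nat).
Implicit Types x : R -> 'rV[R]_d.

(** Finite-partition form of the cadlag property: the times in [l] cut [[0, t[] into pieces on which
    [x] varies by at most [e]. The value at [t] itself is left free, since [x] may jump there. *)
Definition tame (x : R -> 'rV[R]_d) (e t : R) := exists (l : seq R) (C : R),
  (forall s, 0 <= s < t -> `|x s| <= C) /\
  (forall a b, 0 <= a -> a < b -> b <= t -> (forall z, z \in l -> ~~ (a < z < b)) ->
     forall s, a <= s < b -> `|x s - x a| <= e).

(** Supremum argument, as for the compactness of an interval: tameness reaches the supremum of the
    good times and extends beyond it unless it is [T]. *)
Lemma cadlag_tame x (T e : R) : 0 < T -> 0 < e -> cadlag_on T x -> tame x e T.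
Proof.
move=> T0 e0 [rc ll].
have e20 : 0 < e / 2 by rewrite divr_gt0.
have right t : 0 <= t < T ->
    exists2 r, 0 < r & forall s, t <= s < t + r -> `|x s - x t| <= e / 2.
  move=> /rc /cvgr_dist_lt /(_ _ e20) [r /= r0 H]; exists r => // s.
  rewrite le_eqVlt => /andP[/predU1P[<- _|ts str]]; first by rewrite subrr normr0 ltW.
  rewrite distrC ltW// H//= ltr0_norm ?subr_lt0// opprB; lra.
have left t : 0 < t <= T -> exists2 r, 0 < r &
    exists y, forall s, t - r < s < t -> `|x s - y| <= e / 2.
  move=> /ll /cvg_ex[y /cvgr_dist_lt /(_ _ e20) [r /= r0 H]]; exists r => //; exists y => s.
  move=> /andP[s1 s2]; rewrite distrC ltW// H//= gtr0_norm ?subr_gt0//; lra.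
pose A := [set t | 0 <= t <= T /\ tame x e t].
have A0 : A 0.
  split; first by rewrite lexx ltW.
  exists [::], 0; split => [s|a b]; lra.
have supA : has_sup A by split; [exists 0|exists T => t [/andP[]]].
set t := sup A.
have t0 : 0 <= t by exact: ub_le_sup supA.2 _ A0.
have tT : t <= T by apply: ge_sup; [exists 0|move=> ? [/andP[]]].
(* tameness up to some [t'] reaches past [t], as one-sided limits at [t] control [x] near [t] *)
have [t' [t't [/andP[t'0 _] [l [C [lC lE]]]] [y yE]]] : exists t', [/\ t' <= t, A t' &
    exists y, forall s, t' <= s < t -> `|x s - y| <= e / 2].
  have [tlt0|] := ltP 0 t; last first.
    move=> tle0; have -> : t = 0 by apply/eqP; rewrite eq_le tle0 t0.
    by exists 0; split => //; exists 0 => s; lra.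
  have [|r r0 [y yE]] := left t; first by rewrite tlt0.
  have [t' At' t't] := sup_adherent r0 supA.
  exists t'; split => //; first exact: ub_le_sup supA.2 _ At'.
  by exists y => s /andP[s1 s2]; apply: yE; rewrite s2 (lt_le_trans t't).
have step u : t <= u <= T -> (forall s, t <= s < u -> `|x s - x t| <= e / 2) -> tame x e u.
  move=> /andP[tu uT] xu.
  (* An interval with neither [t'] nor [t] in its interior lies before [t'], between the two or
     after [t]; in the last two cases [x] stays within [e / 2] of a fixed value, [y] or [x t], hence
     within [e] of [x a]. *)
  exists [:: t', t & l], (`|C| + `|y| + `|x t| + e / 2); split.
    move=> s /andP[s0 su].
    have [st'|t's] := ltP s t'.
      apply: (@le_trans _ _ `|C|); last by rewrite -!addrA lerDl !addr_ge0// ltW.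
      by apply: le_trans (ler_norm _); apply: lC; rewrite s0.
    have [st|ts] := ltP s t.
      have := yE s; rewrite t's st => /(_ isT) H.
      have := ler_normD (x s - y) y; rewrite subrK.
      have := normr_ge0 C; have := normr_ge0 (x t); lra.
    have := xu s; rewrite ts su => /(_ isT) H.
    have := ler_normD (x s - x t) (x t); rewrite subrK.
    have := normr_ge0 C; have := normr_ge0 y; lra.
  move=> a b a0 ab bu nol s /andP[as_ sb].
  have nt' : ~~ (a < t' < b) by apply: nol; rewrite !inE eqxx.
  have nt : ~~ (a < t < b) by apply: nol; rewrite !inE eqxx orbT.
  have tri (z : 'rV[R]_d) : `|x s - z| <= e / 2 -> `|x a - z| <= e / 2 -> `|x s - x a| <= e.
    move=> h1 h2; have -> : x s - x a = (x s - z) - (x a - z) by rewrite opprB addrA subrK.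
    apply: le_trans (ler_normB _ _) _; lra.
  have [bt'|t'b] := leP b t'.
    apply: (lE a b) => //; last by rewrite as_ sb.
    by move=> z zl; apply: nol; rewrite !inE zl !orbT.
  have t'a : t' <= a by move: nt'; rewrite t'b andbT -leNgt.
  have [bt|tb] := leP b t.
    by apply: (tri y); apply: yE; lra.
  have ta : t <= a by move: nt; rewrite tb andbT -leNgt.
  by apply: (tri (x t)); apply: xu; lra.
have [tltT|] := ltP t T; last first.
  move=> Tt; have tE : t = T by apply/eqP; rewrite eq_le tT Tt.
  by rewrite -tE; apply: step => [|s]; lra.
have [|r r0 xr] := right t; first by rewrite t0.
have Au : A (Num.min T (t + r)).
  split; first by rewrite le_min ge_min lexx andbT; lra.
  apply: step.
    by rewrite le_min ge_min lexx tT/= lerDl ltW.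
  by move=> s; rewrite lt_min => /and3P[ts _ sr]; apply: xr; rewrite ts.
have := ub_le_sup supA.2 Au; rewrite -/t ge_min => /orP[|]; lra.
Qed.

Lemma cadlag_bounded x (T : R) : 0 < T -> cadlag_on T x ->
  exists C, forall s, 0 <= s <= T -> `|x s| <= C.
Proof.
move=> T0 /(cadlag_tame T0 ltr01)[l [C [H _]]]; exists (Num.max C `|x T|) => s.
rewrite le_max [s <= T]le_eqVlt andb_orr => /orP[/andP[_ /eqP->]|/H ->//].
by rewrite lexx orbT.
Qed.

End Cadlag.

(** * From L^2 to locally uniform convergence *)

Section LocallyUniform.
Variable R : realType.
Local Notation mu := (@lebesgue_measure R).

(** The integral of a nonnegative function is a supremum over the simple functions below it, hence
    monotone for arbitrary such functions; this spares a measurability proof for the inner integrals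
    of [leb_int]. *)
Lemma le_integralT_nonmeasurable (F G : R -> \bar R) : (forall s, 0 <= F s)%E ->
  (forall s, F s <= G s)%E -> (\int[mu]_s F s <= \int[mu]_s G s)%E.
Proof.
move=> F0 FG; have G0 s : (0 <= G s)%E by exact: le_trans (FG s).
rewrite !ge0_integralTE//; apply: ereal_sup_le => _ [h hF <-]; exists h => // s.
exact: le_trans (FG s).
Qed.

Lemma leb_int_ge0 n (h : 'rV[R]_n -> \bar R) :
  (forall x, 0 <= h x)%E -> (0 <= leb_int h)%E.
Proof. by elim: n h => [|n IH] h h0 //=; apply: integral_ge0 => s _; exact: IH. Qed.

(** A Chebyshev-type bound, by induction on the dimension: confining the first coordinate to an
    interval of length [2 * r] contributes one factor [2 * r]. *)
Lemma leb_int_ge_cube n (h : 'rV[R]_n -> \bar R) (z : 'rV[R]_n) (r c : R) :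
  0 <= r -> 0 <= c -> (forall x, 0 <= h x)%E ->
  (forall x : 'rV[R]_n, (forall i, `|x 0 i - z 0 i| <= r) -> (c%:E <= h x)%E) ->
  ((c * (2 * r) ^+ n)%:E <= leb_int h)%E.
Proof.
move=> r0 c0; elim: n h z => [|n IH] h z h0 hc.
  by rewrite expr0 mulr1 /=; apply: (hc 0); case.
pose z1 := z 0 ord0; pose z2 := rsubmx (z : 'rV_(1 + n)).
pose D := `[z1 - r, z1 + r]%classic.
pose b := c * (2 * r) ^+ n.
have b0 : 0 <= b by rewrite mulr_ge0// exprn_ge0// mulr_ge0.
apply: (@le_trans _ _ (\int[mu]_s (((cst b%:E) \_ D) s))%E).
  rewrite -integral_mkcond integral_cst; last exact: measurable_itv.
  have muD : mu D = (2 * r)%:E.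
    rewrite lebesgue_measure_itv/= lte_fin; case: ltP => rr.
      by rewrite -EFinD; congr EFin; ring.
    by rewrite (_ : r = 0) ?mulr0//; lra.
  by rewrite exprSr mulrA -/b [X in (_ * X)%E]muD -EFinM.
apply: le_integralT_nonmeasurable => s; rewrite patchE; first by case: ifP; rewrite ?lee_fin.
case: ifPn => // sD.
- apply: (IH _ z2) => // y yz; apply: hc => i.
  rewrite -(@splitK 1 n i); case: (@fintype.split 1 n i) => j /=.
  + rewrite (ord1 j) (row_mxEl (const_mx s : 'rV_1)) mxE.
    have -> : lshift n 0 = ord0 :> 'I_(1 + n) by apply/ord_inj.
    by move: sD; rewrite inE /D/= in_itv/= -/z1 ler_distl.
  + by rewrite (row_mxEr (const_mx s : 'rV_1)); have := yz j; rewrite /z2 mxE.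
- exact: leb_int_ge0.
Qed.

(** If [fm m] and [f] differ by more than [delta] at [x], the Lipschitz bounds keep them [delta / 2]
    apart on a cube around [x] whose size depends on neither [x] nor [m]; the squared L^2 distance
    is then at least a fixed [c > 0]. *)
Lemma L2_cvg_locally_uniform d (K : R) (f : 'rV[R]_d -> 'rV[R]_d)
    (fm : nat -> 'rV[R]_d -> 'rV[R]_d) : 0 < K ->
  (forall x y, `|f x - f y| <= K * `|x - y|) ->
  (forall m, (0 < m)%N -> forall x y, `|fm m x - fm m y| <= K * `|x - y|) ->
  (forall D : set 'rV[R]_d, compact D -> (fun m => L2dist2 D (fm m) f) @ \oo --> 0%E) ->
  forall B delta : R, 0 < delta -> exists M, forall m, (M <= m)%N -> (0 < m)%N ->
    forall x, `|x| <= B -> `|fm m x - f x| <= delta.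
Proof.
move=> K0 fK fmK cvgL2 B delta delta0.
(* The bound [1] keeps the cube inside the box [D]; the other one limits the loss [2 * K * r] to
   [delta / 2]. *)
pose r := Num.min 1 (delta / (4 * K)).
have r0 : 0 < r by rewrite lt_min ltr01 divr_gt0// mulr_gt0.
have r1 : r <= 1 by rewrite ge_min lexx.
have rK : 2 * (K * r) <= delta / 2.
  have : r <= delta / (4 * K) by rewrite ge_min lexx orbT.
  by rewrite ler_pdivlMr ?mulr_gt0//; lra.
pose D : set 'rV[R]_d := [set x | forall i, `[- (B + 1), B + 1]%classic (x 0 i)].
have cD : compact D.
  by apply: (@rV_compact R d (fun=> `[- (B + 1), B + 1]%classic)) => i; exact: segment_compact.
pose c := (delta / 2) ^+ 2 * (2 * r) ^+ d.
have c0 : 0 < c by rewrite mulr_gt0// exprn_gt0 ?mulr_gt0 ?divr_gt0.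
have : nbhs 0%E [set y : \bar R | y < c%:E]%E.
  by apply: open_nbhs_nbhs; split; [exact: open_ereal_lt_ereal|rewrite /= lte_fin].
move=> /(cvgL2 D cD) [M _ HM]; exists M => m Mm m0 x xB.
rewrite leNgt; apply/negP => xdelta.
have /= := HM m Mm; apply/negP; rewrite -leNgt.
apply: (leb_int_ge_cube (z := x)).
- exact: ltW.
- exact: sqr_ge0.
- by move=> y; rewrite lee_fin mulr_ge0 ?sqr_ge0.
- move=> y yx; have yxr : `|y - x| <= r.
    by apply: row_norm_le => [|i]; [exact: ltW|rewrite !mxE].
  have yD : D y.
    move=> i /=; rewrite in_itv/= -ler_norml.
    apply: le_trans (coord_le_norm _ _) _.
    by have := ler_normD (y - x) x; rewrite subrK; lra.
  have d20 : 0 <= delta / 2 by lra.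
  rewrite indicE mem_set// mul1r lee_fin lerXn2r ?nnegrE ?sqrtr_ge0//.
  apply: le_trans (norm_le_enorm _).
  have h1 : `|fm m x - fm m y| <= K * r.
    by apply: le_trans (fmK m m0 x y) _; rewrite ler_pM2l// distrC.
  have h2 : `|f y - f x| <= K * r.
    by apply: le_trans (fK y x) _; rewrite ler_pM2l.
  have : fm m x - f x = (fm m x - fm m y) + (fm m y - f y) + (f y - f x).
    by rewrite !addrA !subrK.
  move=> /(congr1 Num.norm) e1.
  have := ler_normD (fm m x - fm m y + (fm m y - f y)) (f y - f x).
  have := ler_normD (fm m x - fm m y) (fm m y - f y).
  lra.
Qed.

End LocallyUniform.

(** * Oscillation of the driving paths on a mesh *)

Section Oscillation.
Variable R : realType.

(** Codes of no rational in [[0, 1[] are sent to [0], so every index gives an admissible time. *)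
Definition rat01 (j : nat) : R :=
  if @unpickle rat j is Some q then (if 0 <= q < 1 then ratr q else 0) else 0.

Lemma rat01_itv j : 0 <= rat01 j < 1.
Proof.
rewrite /rat01; case: unpickle => [q|]; last by rewrite lexx ltr01.
case: ifP => [/andP[q0 q1]|_]; last by rewrite lexx ltr01.
by rewrite ler0q q0 -(rmorph1 (@ratr R)) ltr_rat.
Qed.

Lemma rat01_dense (a b : R) : 0 <= a -> a < b -> b <= 1 -> exists j, a < rat01 j < b.
Proof.
move=> a0 ab b1; have [q] := rat_in_itvoo ab; rewrite in_itv/= => /andP[aq qb].
exists (pickle q); rewrite /rat01 pickleK ifT ?aq//.
by rewrite -(ler0q R) -(ltr_rat R) rmorph1 (le_trans a0 (ltW aq)) (lt_le_trans qb).
Qed.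

Section Path.
Variable d : nat.
Implicit Types (x : R -> 'rV[R]_d) (v : 'rV[R]_d).

(** As a finite sum over coordinates, it inherits measurability along [L] directly from the
    marginals. *)
Definition norm1 v : R := \sum_(i < d) `|v 0 i|.

Lemma norm_le_norm1 v : `|v| <= norm1 v.
Proof.
apply: row_norm_le => [|i]; first exact: sumr_ge0.
by rewrite /norm1 (bigD1 i)//= lerDl sumr_ge0.
Qed.

Lemma norm1_le_norm v : norm1 v <= d%:R * `|v|.
Proof.
apply: (@le_trans _ _ (\sum_(i < d) `|v|)).
  by apply: ler_sum => i _; exact: coord_le_norm.
by rewrite sumr_const card_ord mulr_natl.
Qed.

(* Rational times suffice for cadlag paths and keep the oscillation a random variable. *)
Definition osc x (u dt : R) : R := sups (fun j => norm1 (x (u + rat01 j * dt) - x u)) 0.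

Lemma osc_le x (u dt c : R) : 0 < dt ->
  (forall s, u <= s < u + dt -> `|x s - x u| <= c) -> osc x u dt <= d%:R * c.
Proof.
move=> dt0 xc; apply: ge_sup; first by exists (norm1 (x (u + rat01 0 * dt) - x u)); exists 0%N.
move=> _ [j _ <-]; apply: le_trans (norm1_le_norm _) _; rewrite ler_wpM2l// xc//.
have /andP[j0 j1] := rat01_itv j.
by rewrite lerDl mulr_ge0 ?(ltW dt0)//= ltrD2l gtr_pMl.
Qed.

(** The real [sup] dominates its set only if the set is bounded, so this precedes any use of [osc]
    as an upper bound or as a random variable. *)
Lemma osc_ubound x (T u dt : R) : cadlag_on T x -> 0 < T -> 0 <= u -> 0 < dt -> u + dt <= T ->
  has_ubound (range (fun j => norm1 (x (u + rat01 j * dt) - x u))).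
Proof.
move=> /[swap] T0 /(cadlag_bounded T0)[C xC] u0 dt0 uT.
exists (d%:R * (2 * C)) => _ [j _ <-]; apply: le_trans (norm1_le_norm _) _.
have /andP[j0 j1] := rat01_itv j.
have jdt0 : 0 <= rat01 j * dt by rewrite mulr_ge0// ltW.
have jdt1 : rat01 j * dt < dt by rewrite gtr_pMl.
rewrite ler_wpM2l//; apply: le_trans (ler_normB _ _) _.
have := xC (u + rat01 j * dt); have := xC u; lra.
Qed.

(** By right continuity, an excess over the supremum at time [s] would persist at a rational time
    just after [s] in the same cell. *)
Lemma le_osc x (T u dt s : R) : cadlag_on T x -> 0 < T -> 0 <= u -> 0 < dt -> u + dt <= T ->
  u <= s < u + dt -> `|x s - x u| <= osc x u dt.
Proof.
move=> cx T0 u0 dt0 uT /andP[us su]; rewrite leNgt; apply/negP => ltosc.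
have sT : 0 <= s < T by lra.
have gap : 0 < `|x s - x u| - osc x u dt by rewrite subr_gt0.
have /cvgr_dist_lt /(_ _ gap) [r /= r0 xr] := cx.1 s sT.
pose b := Num.min (s + r) (u + dt).
have sb : s < b by rewrite lt_min ltrDl r0.
have br : b <= s + r by rewrite ge_min lexx.
have bu : b <= u + dt by rewrite ge_min lexx orbT.
have [||| j /andP[j1 j2]] := @rat01_dense ((s - u) / dt) ((b - u) / dt).
- by rewrite divr_ge0 ?subr_ge0// ltW.
- by rewrite ltr_pM2r ?invr_gt0// ltrD2r.
- by rewrite ler_pdivrMr//; lra.
move: j1 j2; rewrite ltr_pdivrMr// ltr_pdivlMr// => j1 j2.
set q := u + rat01 j * dt.
have sq : `|x s - x q| < `|x s - x u| - osc x u dt.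
  by apply: xr => /=; rewrite ?ltr0_norm ?subr_lt0; rewrite /q; lra.
have : `|x q - x u| <= osc x u dt.
  apply: le_trans (norm_le_norm1 _) _; apply: ub_le_sup; last by exists j.
  have [M xM] := osc_ubound cx T0 u0 dt0 uT.
  by exists M => z [k _ <-]; apply: xM; exists k.
have := ler_normD (x s - x q) (x q - x u); rewrite addrA subrK; lra.
Qed.

(** [T] times the mean of the cell oscillations, the form in which one-step errors [dt * osc] add
    up. Unlike the largest oscillation, it tends to 0 even when the path jumps. *)
Definition mesh_osc x (T : R) (N : nat) : R :=
  \sum_(k < N) T / N%:R * osc x (k%:R * (T / N%:R)) (T / N%:R).

(** The indicator on the right, in place of [1], carries the induction: a point already counted lies
    to the left of the next cell. *)
Lemma cell_count (dt z : R) (N : nat) : 0 < dt ->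
  \sum_(k < N) (k%:R * dt < z < k.+1%:R * dt)%R%:R <= (z < N%:R * dt)%R%:R :> R.
Proof.
move=> dt0; elim: N => [|N IH]; first by rewrite big_ord0.
rewrite big_ord_recr/=; move: IH.
have -> : N.+1%:R * dt = N%:R * dt + dt by rewrite -natr1 mulrDl mul1r.
by case: (ltrgtP z (N%:R * dt)) => h /=; case: ltP => /= h2; lra.
Qed.

(** Cells with no exceptional time inside contribute at most [eta / 2] in total; at most [size l]
    cells remain, each of weight [dt], so their share vanishes as the mesh is refined. *)
Lemma mesh_osc_cvg0 x (T eta : R) : 0 < T -> cadlag_on T x -> 0 < eta ->
  exists n, forall N, (n <= N)%N -> mesh_osc x T N <= eta.
Proof.
move=> T0 cx eta0; pose D : R := d%:R + 1.
have D0 : 0 < D by rewrite ltr_wpDl.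
(* Makes [D * e * T], the share of the regular cells, equal to [eta / 2]; [D] replaces [d] so as to
   be positive even for [d = 0]. *)
pose e := eta / (2 * D * T).
have e0 : 0 < e by rewrite divr_gt0// !mulr_gt0.
have [l [_ [_ xe]]] := cadlag_tame T0 e0 cx.
have [C xC] := cadlag_bounded T0 cx.
have C0 : 0 <= C by apply: le_trans (normr_ge0 _) (xC 0 _); rewrite lexx ltW.
pose A := D * (2 * C * (size l)%:R) * T.
exists (Num.truncn (2 * A / eta)).+1 => N nN.
have N0 : (0 < N)%N by apply: leq_trans nN.
have NR0 : 0 < N%:R :> R by rewrite ltr0n.
set dt := T / N%:R.
have dt0 : 0 < dt by rewrite divr_gt0.
have NA : 2 * A / eta <= N%:R.
  have := truncnS_gt (2 * A / eta) => /ltW/le_trans; apply.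
  by rewrite ler_nat.
have Ndt : N%:R * dt = T by rewrite mulrC divfK ?gt_eqF.
(* Counts the exceptional times inside cell [k]; a single one already pays for the crude bound
   [2 * C]. *)
pose cnt (k : nat) : R := \sum_(z <- l) (k%:R * dt < z < k.+1%:R * dt)%R%:R.
have cell (k : 'I_N) : osc x (k%:R * dt) dt <= d%:R * (e + 2 * C * cnt k).
  have cnt0 : 0 <= cnt k by exact: sumr_ge0.
  have Sk : k%:R * dt + dt = k.+1%:R * dt by rewrite -natr1 mulrDl mul1r.
  have k0 : 0 <= k%:R * dt by rewrite mulr_ge0// ltW.
  have kT : k.+1%:R * dt <= T by rewrite -Ndt ler_pM2r// ler_nat.
  apply: osc_le => // s; rewrite Sk => ks.
  have [/hasP[z zl zk]|/hasPn noz] := boolP (has (fun z => k%:R * dt < z < k.+1%:R * dt) l).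
    have cnt1 : 1 <= cnt k.
      rewrite /cnt (big_rem z)//= zk lerDl; exact: sumr_ge0.
    apply: le_trans (ler_normB _ _) _.
    have h1 := xC s; have h2 := xC (k%:R * dt).
    have : 2 * C <= 2 * C * cnt k by rewrite ler_peMr// mulr_ge0.
    by have := h1 _; have := h2 _; lra.
  apply: (@le_trans _ _ e); last by rewrite lerDl !mulr_ge0.
  apply: (xe _ (k.+1%:R * dt)) => //; lra.
have sumcnt : \sum_(k < N) cnt k <= (size l)%:R.
  rewrite /cnt exchange_big/= -sum1_size natr_sum ler_sum// => z _.
  apply: le_trans (cell_count z N dt0) _.
  by case: (_ < _).
have dD : d%:R <= D by rewrite lerDl.
have De : N%:R * (D * e) * dt = eta / 2.
  rewrite -mulrA [D * e * dt]mulrC mulrA Ndt /e; field; by rewrite !gt_eqF.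
have Adt : D * (2 * C * (size l)%:R) * dt <= eta / 2.
  have -> : D * (2 * C * (size l)%:R) * dt = A / N%:R by rewrite /A /dt mulrA.
  rewrite ler_pdivrMr//; move: NA; rewrite ler_pdivrMr//; lra.
apply: (@le_trans _ _ (\sum_(k < N) dt * (D * (e + 2 * C * cnt k)))).
  apply: ler_sum => k _; rewrite ler_pM2l//; apply: le_trans (cell k) _.
  have cnt0 : 0 <= cnt k by exact: sumr_ge0.
  rewrite ler_wpM2r// addr_ge0//; first exact: ltW.
  by rewrite !mulr_ge0.
rewrite -mulr_sumr -mulr_sumr big_split/= sumr_const card_ord -mulr_sumr -mulr_natl.
have : D * (2 * C * \sum_(k < N) cnt k) * dt <= D * (2 * C * (size l)%:R) * dt.
  by rewrite ler_pM2r// ler_pM2l// ler_wpM2l// mulr_ge0.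
lra.
Qed.

End Path.

(** * Measurability, and control of the paths off a small event *)

Section Measurable.
Context (d0 : measure_display) (Omega : measurableType d0) (P : probability Omega R).
Variables (d : nat) (L : Omega -> R -> 'rV[R]_d) (T : R).
Hypotheses (T0 : 0 < T) (mL : forall t i, measurable_fun setT (fun w => L w t 0 i))
  (cL : forall w, cadlag_on T (L w)).

Lemma measurable_osc (u dt : R) : 0 <= u -> 0 < dt -> u + dt <= T ->
  measurable_fun setT (fun w => osc (L w) u dt).
Proof.
move=> u0 dt0 uT; apply: measurable_fun_sups => [w _|j]; first exact: osc_ubound (cL w) _ _ _ _.
apply: measurable_sum => i; apply: measurableT_comp => //.
rewrite (_ : (fun w => _) = (fun w => L w (u + rat01 j * dt) 0 i - L w u 0 i)).
  exact: measurable_funB.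
by apply/funext => w; rewrite !mxE.
Qed.

Lemma measurable_mesh_osc (N : nat) : measurable_fun setT (fun w => mesh_osc (L w) T N).
Proof.
apply: measurable_sum => k; apply: measurable_funM => //.
have N0 : 0 < N%:R :> R by rewrite ltr0n (leq_ltn_trans _ (ltn_ord k)).
have dt0 : 0 < T / N%:R by rewrite divr_gt0.
apply: measurable_osc => //; first by rewrite mulr_ge0// ltW.
rewrite -{2}[T / _]mul1r -mulrDl natr1 mulrCA -[leRHS]mulr1 ler_pM2l//.
by rewrite ler_pdivrMr// mul1r ler_nat.
Qed.

(** Continuity from above: the bad events [A n] decrease to the empty set, because each single path
    is bounded and has vanishing mesh oscillation. *)
Lemma path_control (eta eps : R) : 0 < eta -> 0 < eps ->
  exists (n : nat) (c : R) (B : set Omega), [/\ measurable B, (P B < eps%:E)%E &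
    forall w, ~ B w -> (forall t, 0 <= t <= T -> `|L w t| <= c) /\
      forall N, (n <= N)%N -> mesh_osc (L w) T N <= eta].
Proof.
move=> eta0 eps0.
(* A measurable bound for the whole path: [[0, T[] is treated as one cell, and the excluded end [T]
   gets its own term. *)
pose S w := osc (L w) 0 T + (norm1 (L w 0) + norm1 (L w T)).
have mnorm1 t : measurable_fun setT (fun w => norm1 (L w t)).
  by apply: measurable_sum => i; apply: measurableT_comp.
have mS : measurable_fun setT S.
  apply: measurable_funD; last exact: measurable_funD.
  by apply: measurable_osc; rewrite ?add0r.
have LS w t : 0 <= t <= T -> `|L w t| <= S w.
  have osc0 : 0 <= osc (L w) 0 T.
    apply: le_trans (normr_ge0 (L w 0 - L w 0)) _.
    by apply: (le_osc (T := T)) => //; rewrite ?add0r ?lexx.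
  have n0 s : 0 <= norm1 (L w s) by exact: sumr_ge0.
  move=> /andP[t0]; rewrite le_eqVlt => /predU1P[->|tT].
    have := norm_le_norm1 (L w T); have := n0 0; rewrite /S; lra.
  have : `|L w t - L w 0| <= osc (L w) 0 T.
    by apply: (le_osc (T := T)) => //; rewrite ?add0r ?t0.
  have := norm_le_norm1 (L w 0); have := n0 T.
  have := ler_normD (L w t - L w 0) (L w 0); rewrite subrK /S; lra.
have mgt (F : Omega -> R) c : measurable_fun setT F -> measurable [set w | c < F w].
  move=> mF; rewrite (_ : [set w | _] = setT `&` F @^-1` `]c, +oo[).
    by apply: mF => //; exact: measurable_itv.
  by rewrite setTI; apply/seteqP; split => w /=; rewrite in_itv/= andbT.
pose A n := [set w | n%:R < S w] `|`
  \bigcup_(N in [set N | (n <= N)%N]) [set w | eta < mesh_osc (L w) T N].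
have mA n : measurable (A n).
  apply: measurableU; first exact: mgt.
  by apply: bigcup_measurable => N _; apply: mgt; exact: measurable_mesh_osc.
have A0 : \bigcap_n A n = set0.
  apply/seteqP; split => // w wA.
  have [n Hn] := mesh_osc_cvg0 T0 (cL w) eta0.
  have [] := wA (maxn n (Num.truncn (S w)).+1) I => /=.
    apply/negP; rewrite -leNgt; apply: le_trans (ltW (truncnS_gt _)) _.
    by rewrite ler_nat leq_maxr.
  move=> [N /= nN]; apply/negP; rewrite -leNgt; apply: Hn.
  by apply: leq_trans nN; rewrite leq_maxl.
have cvA : (P \o A) @ \oo --> 0%E.
  rewrite -(measure0 P) -A0; apply: nonincreasing_cvg_mu => //.
  - by apply: le_lt_trans (probability_le1 _ _) _ => //; rewrite ltry.
  - exact: bigcap_measurable.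
  - move=> m n mn; apply/subsetPset => w [Sw|[N /= nN Nw]].
      by left; apply: le_lt_trans Sw; rewrite ler_nat.
    by right; exists N => //=; apply: leq_trans nN.
have : nbhs 0%E [set y : \bar R | y < eps%:E]%E.
  by apply: open_nbhs_nbhs; split; [exact: open_ereal_lt_ereal|rewrite /= lte_fin].
move=> /cvA [n _ /(_ n (leqnn n)) /= PA].
exists n, n%:R, (A n); split => // w nA; split => [t tT|N nN].
  apply: le_trans (LS w t tT) _; rewrite leNgt; apply/negP => h.
  by apply: nA; left.
by rewrite leNgt; apply/negP => h; apply: nA; right; exists N.
Qed.

End Measurable.
End Oscillation.

(** * Gronwall bounds and drift increments *)

Section Gronwall.
Variable R : realType.

(** Gronwall with suprema in place of integrals of [V]. The a priori bound [C] only makes these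
    suprema finite; [B] is chosen before [V], hence serves all sample paths at once. *)
Lemma gronwall_bound (T K a v0 : R) : 0 < T -> 0 <= K -> 0 <= a -> exists B, forall V : R -> R,
  (forall t, 0 <= V t) -> (exists C, forall t, 0 <= t <= T -> V t <= C) -> V 0 <= v0 ->
  (forall s t M, 0 <= s -> s <= t -> t <= T -> (forall u, s <= u < t -> V u <= M) ->
     V t <= V s + (t - s) * (a + K * M)) ->
  forall t, 0 <= t <= T -> V t <= B.
Proof.
(* With [n] steps of length [tau], [K * tau <= 1 / 2], so half of the supremum over a step is
   absorbed; this yields the recursion [b]. *)
move=> T0 K0 a0; pose n := (Num.truncn (2 * K * T)).+1.
pose b k := iter k (fun b => 2 * (b + T * a)) `|v0|.
have b0 k : 0 <= b k.
  by elim: k => [|k IH] /=; [exact: normr_ge0|rewrite mulr_ge0// addr_ge0// mulr_ge0// ltW].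
exists (b n) => V V0 [C VC] Vv0 Vinc.
pose tau := T / n%:R.
have n0 : 0 < n%:R :> R by rewrite ltr0n.
have tau0 : 0 < tau by rewrite divr_gt0.
have ntau : n%:R * tau = T by rewrite mulrC divfK ?gt_eqF.
have Ktau : K * tau <= 1 / 2.
  have : 2 * K * T <= n%:R by exact: ltW (truncnS_gt _).
  by rewrite -ntau mulrCA -[leRHS]mulr1 ler_pM2l//; lra.
suff H k : (k <= n)%N -> forall t, 0 <= t <= k%:R * tau -> V t <= b k.
  by move=> t tT; apply: H => //; rewrite ntau.
elim: k => [_ t|k IH kn t].
  rewrite mul0r => /andP[t0 t1]; have -> : t = 0 by apply/eqP; rewrite eq_le t0 t1.
  exact: le_trans (ler_norm _).
have {}IH := IH (ltnW kn).
have k0 : 0 <= k%:R * tau by rewrite mulr_ge0// ltW.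
have Sk : k.+1%:R * tau = k%:R * tau + tau by rewrite -natr1 mulrDl mul1r.
have kT : k%:R * tau + tau <= T by rewrite -Sk -ntau ler_pM2r// ler_nat.
have bk0 := b0 k; have Ta0 : 0 <= T * a by rewrite mulr_ge0// ltW.
rewrite Sk => /andP[t0 tk] /=; rewrite -/(b k).
have [tk'|kt] := leP t (k%:R * tau); first by have := IH t; rewrite t0 tk'; lra.
pose A := [set V u | u in [set u | k%:R * tau <= u <= k%:R * tau + tau]].
have ubA : has_ubound A by exists C => _ [u /= uk <-]; apply: VC; lra.
have AE u : k%:R * tau <= u <= k%:R * tau + tau -> V u <= sup A.
  by move=> uk; apply: ub_le_sup => //; exists u.
have supA0 : 0 <= sup A by apply: le_trans (V0 t) (AE t _); lra.
have supA : sup A <= b k + (T * a + sup A / 2).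
  apply: ge_sup; first by exists (V t), t => //=; lra.
  move=> _ [u /= /andP[uk ku] <-].
  have /(_ (sup A)) := Vinc (k%:R * tau) u _ k0 uk.
  have Vk : V (k%:R * tau) <= b k by apply: IH; rewrite k0 lexx.
  have uT : u <= T by lra.
  move=> /(_ uT) H.
  have {}H := H _; have {}H : V u <= V (k%:R * tau) + (u - k%:R * tau) * (a + K * sup A).
    by apply: H => v /andP[v1 v2]; apply: AE; lra.
  have h1 : (u - k%:R * tau) * a <= T * a by rewrite ler_wpM2r//; lra.
  have h2 : (u - k%:R * tau) * (K * sup A) <= tau * (K * sup A).
    by rewrite ler_wpM2r ?mulr_ge0//; lra.
  have h3 : tau * (K * sup A) <= sup A / 2.
    by have := ler_wpM2r supA0 Ktau; lra.
  lra.
have := AE t; rewrite (ltW kt) tk => /(_ isT); lra.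
Qed.

End Gronwall.

Section Paths.
Variables (R : realType) (d : nat).
Local Notation mu := (@lebesgue_measure R).

Lemma skorokhod_dist_le_uniform (T delta : R) (x y : R -> 'rV[R]_d) : 0 <= delta ->
  (forall t, 0 <= t <= T -> enorm (x t - y t) <= delta) ->
  (skorokhod_dist T x y <= delta%:E)%E.
Proof.
move=> delta0 xy; apply: (@le_trans _ _ (Order.max
    (ereal_sup [set (`|t - t|)%:E | t in `[0, T]])
    (ereal_sup [set (enorm (x t - y t))%:E | t in `[0, T]]))).
  apply: ereal_inf_lbound; exists id => //; split; last by split=> // s t _ _.
  by apply: continuous_subspaceT => t.
rewrite ge_max; apply/andP; split; apply: ge_ereal_sup => _ [t /= tT <-].
  by rewrite subrr normr0 lee_fin.
by move: tT; rewrite in_itv/= lee_fin => tT; exact: xy.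
Qed.

Section Drift.
Variables (T g : R) (x0 : 'rV[R]_d) (h Z L : R -> 'rV[R]_d).
Hypothesis ih : forall i, mu.-integrable `[0, T] (fun s => (h s 0 i)%:E).
Hypothesis ZE : forall t, 0 <= t <= T -> forall i,
  ((Z t 0 i)%:E = (x0 0 i)%:E + (\int[mu]_(s in `[0%R, t]) (h s 0 i)%:E) + (g * L t 0 i)%:E)%E.

Let ih_sub t i : t <= T -> mu.-integrable `[0, t] (fun s => (h s 0 i)%:E).
Proof.
move=> tT; apply: integrableS (ih i) => // s /=; rewrite !in_itv/= => /andP[-> st].
exact: le_trans tT.
Qed.

(** Integrability makes the extended-real integral finite, so the equation can be read in [R]. *)
Let driftE t i : 0 <= t <= T ->
  Z t 0 i - g * L t 0 i = x0 0 i + \int[mu]_(s in `[0, t]) h s 0 i.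
Proof.
move=> tT; have := ZE tT i.
have tT' : t <= T by case/andP: tT.
rewrite -[X in (_ + X + _)%E]fineK; last exact: integrable_fin_num (ih_sub i tT').
by rewrite -!EFinD => -[->]; rewrite /Rintegral; ring.
Qed.

Lemma drift0 : 0 <= T -> Z 0 - g *: L 0 = x0.
Proof.
move=> T0; apply/rowP => i; rewrite !mxE driftE ?lexx//.
by rewrite set_itv1 Rintegral_set1 addr0.
Qed.

Lemma drift_bounded : exists C, forall t, 0 <= t <= T -> `|Z t - g *: L t| <= C.
Proof.
exists (`|x0| + \sum_i \int[mu]_(s in `[0, T]) `|h s 0 i|) => t tT.
have I0 i : 0 <= \int[mu]_(s in `[0, T]) `|h s 0 i| by apply: Rintegral_ge0.
apply: row_norm_le => [|i]; first by rewrite addr_ge0// sumr_ge0.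
have tT' : t <= T by case/andP: tT.
rewrite !mxE driftE//; apply: le_trans (ler_normD _ _) _; apply: lerD (coord_le_norm _ _) _.
apply: le_trans (le_normr_Rintegral _ (ih_sub i tT')) _ => //.
rewrite (bigD1 i)//=; apply: ler_wpDr; first exact: sumr_ge0.
have iabs u : u <= T -> mu.-integrable `[0, u] (fun s => (`|h s 0 i|)%:E).
  by move=> uT; exact: integrable_norm (ih_sub i uT).
apply: fine_le; [exact: integrable_fin_num (iabs _ tT')|exact: integrable_fin_num (iabs _ (lexx T))|].
apply: ge0_subset_integral => //.
- exact: measurable_int (iabs _ (lexx T)).
- by move=> s /=; rewrite !in_itv/= => /andP[-> /le_trans]; apply.
Qed.

(** The noise cancels in [Z - g *: L]. With [v = 0] this bounds how far the path drifts; with [v]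
    the drift at the left mesh point it is a one-step error. *)
Lemma drift_increment (a b M : R) (v : 'rV[R]_d) : 0 <= a -> a <= b -> b <= T ->
  (forall s, a <= s < b -> `|h s - v| <= M) ->
  `|(Z b - g *: L b) - (Z a - g *: L a) - (b - a) *: v| <= (b - a) * M.
Proof.
move=> a0 ab bT hM; apply: row_norm_le => [|i].
  (* For [a = b] the bound on [h] is vacuous and [M] may be negative, but the right-hand side is
     then [0]. *)
  move: ab; rewrite le_eqVlt => /predU1P[->|ab]; first by rewrite subrr mul0r.
  rewrite mulr_ge0 ?subr_ge0 ?(ltW ab)//; apply: le_trans (normr_ge0 _) (hM a _).
  by rewrite lexx ab.
rewrite !mxE !driftE; try lra.
have -> (p q r s : R) : p + q - (p + r) - s = q - r - s by ring.
apply: integral_increment (ih i) a0 ab bT _ => s /hM; apply: le_trans.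
by have := coord_le_norm (h s - v) i; rewrite !mxE.
Qed.

End Drift.
End Paths.

(** * The Euler-Maruyama error *)

Section Paths.
Variables (R : realType) (d : nat).
Local Notation mu := (@lebesgue_measure R).

Definition drift_solution (T g : R) (x0 : 'rV[R]_d) (h Z L : R -> 'rV[R]_d) :=
  forall t, 0 <= t <= T -> forall i : 'I_d,
  ((Z t 0 i)%:E = (x0 0 i)%:E + (\int[mu]_(s in `[0%R, t]) (h s 0 i)%:E) + (g * L t 0 i)%:E)%E.

(** Gronwall for [Y - g *: L], by linear growth of [f]. The bound is common to all driving paths
    bounded by [c], so the approximation of [f] is only needed on one fixed ball. *)
Lemma solution_bounded (T K g c : R) (x0 : 'rV[R]_d) (f : 'rV[R]_d -> 'rV[R]_d) :
  0 < T -> 0 <= K -> 0 <= c -> (forall x y, `|f x - f y| <= K * `|x - y|) ->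
  exists B, forall (Y L : R -> 'rV[R]_d),
    (forall i, mu.-integrable `[0, T] (fun s => (f (Y s) 0 i)%:E)) ->
    drift_solution T g x0 (fun s => f (Y s)) Y L ->
    (forall t, 0 <= t <= T -> `|L t| <= c) ->
    forall t, 0 <= t <= T -> `|Y t| <= B.
Proof.
move=> T0 K0 c0 fK.
have a0 : 0 <= `|f 0| + K * (`|g| * c) by rewrite addr_ge0// !mulr_ge0.
have [B HB] := gronwall_bound `|x0| T0 K0 a0.
exists (B + `|g| * c) => Y L iY YE Lc t tT.
have gL s : 0 <= s <= T -> `|g *: L s| <= `|g| * c.
  by move=> sT; rewrite normrZ ler_wpM2l// Lc.
have YV s : 0 <= s <= T -> `|Y s| <= `|Y s - g *: L s| + `|g| * c.
  move=> sT; have := ler_normD (Y s - g *: L s) (g *: L s); rewrite subrK.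
  have := gL s sT; lra.
apply: le_trans (YV t tT) _; rewrite lerD2r.
apply: (HB (fun s => `|Y s - g *: L s|)) => //.
- have [C YC] := drift_bounded iY YE; by exists C.
- by rewrite (drift0 iY YE)// ltW.
- move=> a b M a0' ab bT VM.
  have := @drift_increment _ _ _ _ _ _ _ _ iY YE a b (`|f 0| + K * (`|g| * c) + K * M) 0 a0' ab bT.
  rewrite scaler0 subr0 => H.
  have := ler_normD (Y b - g *: L b - (Y a - g *: L a)) (Y a - g *: L a); rewrite subrK => tri.
  apply: le_trans tri _; rewrite addrC lerD2l.
  apply: H => s /[dup] sab /VM VsM; rewrite subr0.
  have := fK (Y s) 0; rewrite subr0.
  have sT : 0 <= s <= T by lra.
  have := ler_wpM2l K0 (YV s sT); have := ler_wpM2l K0 VsM.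
  have := ler_normD (f (Y s) - f 0) (f 0); rewrite subrK; lra.
Qed.

(** Discrete Gronwall: each cell multiplies the error [W] by at most [1 + K * dt] and adds [beta k];
    the final [gam * c] converts from [W] back to [Y - X]. *)
Lemma euler_error (T K CF c delta gam g g' : R) (N : nat) (x0 : 'rV[R]_d)
    (f phi : 'rV[R]_d -> 'rV[R]_d) (Y X L : R -> 'rV[R]_d) (dt := T / N%:R) :
  0 < T -> 0 <= K -> 0 <= delta -> (0 < N)%N -> cadlag_on T L ->
  (forall x y, `|f x - f y| <= K * `|x - y|) ->
  (forall x y, `|phi x - phi y| <= K * `|x - y|) ->
  (forall i, mu.-integrable `[0, T] (fun s => (f (Y s) 0 i)%:E)) ->
  drift_solution T g x0 (fun s => f (Y s)) Y L ->
  drift_solution T g' x0 (fun s => phi (X ((Num.floor (s / dt))%:~R * dt))) X L ->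
  (forall t, 0 <= t <= T -> `|L t| <= c) ->
  (forall t, 0 <= t <= T -> `|f (Y t)| <= CF) ->
  (forall t, 0 <= t <= T -> `|phi (Y t) - f (Y t)| <= delta) ->
  `|g - g'| <= gam ->
  forall t, 0 <= t <= T -> `|Y t - X t| <=
    expR (K * T) * (K * `|g| * mesh_osc L T N + T * (K * dt * CF + delta + K * (gam * c))) + gam * c.
Proof.
move=> T0 K0 delta0 N0 cL fK phiK iY YE XE Lc fC phif ggam.
have N0R : 0 < N%:R :> R by rewrite ltr0n.
have dt0 : 0 < dt by rewrite divr_gt0.
have Ndt : N%:R * dt = T by rewrite mulrC divfK ?gt_eqF.
have zT : 0 <= (0 : R) <= T by apply/andP; split => //; exact: ltW.
have c0 : 0 <= c by exact: le_trans (normr_ge0 _) (Lc 0 zT).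
have CF0 : 0 <= CF by exact: le_trans (normr_ge0 _) (fC 0 zT).
have gam0 : 0 <= gam by exact: le_trans (normr_ge0 _) ggam.
have iX i : mu.-integrable `[0, T] (fun s => (phi (X ((Num.floor (s / dt))%:~R * dt)) 0 i)%:E).
  by have := @integrable_step R (fun k => phi (X (k%:~R * dt)) 0 i) dt N dt0; rewrite Ndt.
pose U t := Y t - g *: L t; pose V t := X t - g' *: L t; pose W t := U t - V t.
have YXW t : 0 <= t <= T -> `|Y t - X t| <= `|W t| + gam * c.
  move=> tT; have -> : Y t - X t = W t + (g - g') *: L t.
    by apply/rowP => i; rewrite /W /U /V !mxE; ring.
  apply: le_trans (ler_normD _ _) _; rewrite lerD2l normrZ; apply: ler_pM => //.
  exact: Lc.
(* In order: the drift of [Y] within a cell, the error of [phi] along [Y], and the passage from [X]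
   and [Y] to [W]. *)
pose rho := K * dt * CF + delta + K * (gam * c).
have rho0 : 0 <= rho by rewrite !addr_ge0// !mulr_ge0// ltW.
pose O k := osc L (k%:R * dt) dt.
have kN k : (k < N)%N -> [/\ 0 <= k%:R * dt, k.+1%:R * dt = k%:R * dt + dt & k%:R * dt + dt <= T].
  move=> kN; split; first by rewrite mulr_ge0// ltW.
    by rewrite -natr1 mulrDl mul1r.
  by rewrite -Ndt -{2}[dt]mul1r -mulrDl natr1 ler_pM2r// ler_nat.
have O0 k : (k < N)%N -> 0 <= O k.
  move=> /kN[k0 Sk kT]; apply: le_trans (normr_ge0 (L (k%:R * dt) - L (k%:R * dt))) _.
  by apply: (le_osc cL) => //; rewrite lexx ltrDl.
pose beta k := dt * (K * `|g| * O k + rho).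
have cell k t : (k < N)%N -> k%:R * dt <= t <= k%:R * dt + dt ->
    `|W t| <= (1 + K * dt) * `|W (k%:R * dt)| + beta k.
  move=> /[dup] /O0 Ok0 /[dup] kltN /kN[k0 Sk kT] /andP[kt tk].
  set a := k%:R * dt in k0 Sk kT kt tk *.
  have tT : t <= T by lra.
  have hY s : a <= s < t -> `|f (Y s) - f (Y a)| <= K * (dt * CF + `|g| * O k).
    move=> sat; apply: le_trans (fK _ _) _; rewrite ler_wpM2l//.
    have -> : Y s - Y a = (U s - U a) + g *: (L s - L a).
      by apply/rowP => i; rewrite /U !mxE; ring.
    apply: le_trans (ler_normD _ _) _; apply: lerD.
      have as_ : a <= s by lra.
      have sT : s <= T by lra.
      have := @drift_increment _ _ _ _ _ _ _ _ iY YE a s CF 0 k0 as_ sT.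
      rewrite scaler0 subr0 => H.
      have {H} := H _; move=> H; apply: le_trans (H _) _.
        by move=> u uas; rewrite subr0 fC//; lra.
      by rewrite ler_wpM2r//; lra.
    rewrite normrZ ler_wpM2l//; apply: (le_osc cL) => //; lra.
  (* The Euler drift is constant on the cell, so the increment of [V] carries no error. *)
  have hX s : a <= s < t -> `|phi (X ((Num.floor (s / dt))%:~R * dt)) - phi (X a)| <= 0.
    move=> sat; rewrite (@floor_cell _ _ _ k dt0); first by rewrite subrr normr0.
    by rewrite Sk -/a; lra.
  have incY := @drift_increment _ _ _ _ _ _ _ _ iY YE a t _ _ k0 kt tT hY.
  have incX := @drift_increment _ _ _ _ _ _ _ _ iX XE a t _ _ k0 kt tT hX.
  rewrite mulr0 in incX.
  (* Inserting [phi (Y a)] means that [phi] and [f] are compared only along [Y], whose range is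
     controlled. *)
  have dif : `|f (Y a) - phi (X a)| <= K * `|W a| + (delta + K * (gam * c)).
    have aT : 0 <= a <= T by lra.
    have := phif a aT; have := phiK (Y a) (X a); rewrite distrC => h1.
    rewrite distrC => h2.
    have := ler_wpM2l K0 (YXW a aT).
    have := ler_normD (f (Y a) - phi (Y a)) (phi (Y a) - phi (X a)).
    rewrite addrA subrK (distrC (phi (Y a)) (phi (X a))); lra.
  have -> : W t = W a + ((U t - U a - (t - a) *: f (Y a)) - (V t - V a - (t - a) *: phi (X a)) +
      (t - a) *: (f (Y a) - phi (X a))).
    by apply/rowP => i; rewrite /W !mxE; ring.
  have ta0 : 0 <= t - a by lra.
  have ta : t - a <= dt by lra.
  have n1 := ler_normD (W a) ((U t - U a - (t - a) *: f (Y a)) - (V t - V a - (t - a) *: phi (X a)) +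
      (t - a) *: (f (Y a) - phi (X a))).
  have n2 := ler_normD ((U t - U a - (t - a) *: f (Y a)) - (V t - V a - (t - a) *: phi (X a)))
      ((t - a) *: (f (Y a) - phi (X a))).
  have n3 := ler_normB (U t - U a - (t - a) *: f (Y a)) (V t - V a - (t - a) *: phi (X a)).
  rewrite normrZ (ger0_norm ta0) in n2.
  have n4 := ler_wpM2l ta0 dif.
  have n5 : (t - a) * (K * (dt * CF + `|g| * O k) + (K * `|W a| + (delta + K * (gam * c)))) <=
      dt * (K * (dt * CF + `|g| * O k) + (K * `|W a| + (delta + K * (gam * c)))).
    by rewrite ler_wpM2r// !(addr_ge0, mulr_ge0)// ltW.
  rewrite /beta /rho; rewrite -/(U t) -/(U a) in incY; rewrite -/(V t) -/(V a) in incX.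
  lra.
have W0 : W 0 = 0 by rewrite /W /U /V (drift0 iY YE) ?(drift0 iX XE) ?subrr ?ltW.
have Kdt0 : 0 <= K * dt by rewrite mulr_ge0// ltW.
have beta0 k : (k < N)%N -> 0 <= beta k.
  by move=> /O0 ?; rewrite mulr_ge0 ?(ltW dt0)// addr_ge0// !mulr_ge0.
(* A closed-form majorant of the recursion: every [beta j] receives the full power of
   [1 + K * dt]. *)
pose G k := (1 + K * dt) ^+ k * \sum_(j < k) beta j.
have pow1 k : 1 <= (1 + K * dt) ^+ k by rewrite exprn_ege1// lerDl.
have G_step k : (k < N)%N -> 0 <= G k -> (1 + K * dt) * G k + beta k <= G k.+1.
  move=> kltN Gk0; rewrite /G big_ord_recr/= exprS mulrDr mulrA lerD2l.
  by rewrite ler_peMl ?beta0// -exprS.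
have G0 k : (k <= N)%N -> 0 <= G k.
  move=> kN'; apply: mulr_ge0; first exact: le_trans ler01 (pow1 k).
  by apply: sumr_ge0 => j _; rewrite beta0// (leq_trans (ltn_ord j)).
have WG k : (k <= N)%N -> forall t, 0 <= t <= k%:R * dt -> `|W t| <= G k.
  elim: k => [_ t|k IH kltN t].
    rewrite mul0r => /andP[t0 t1]; have -> : t = 0 by apply/eqP; rewrite eq_le t0 t1.
    by rewrite W0 normr0 G0.
  have [k0 Sk kT] := kN k kltN; rewrite Sk => /andP[t0 tk].
  have Gk0 := G0 k (ltnW kltN).
  apply: le_trans (G_step k kltN Gk0).
  have {}IH := IH (ltnW kltN).
  have [tk'|kt] := leP t (k%:R * dt).
    have := IH t; rewrite t0 tk' => /(_ isT) Wt.
    have := mulr_ge0 Kdt0 Gk0; have := beta0 k kltN; lra.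
  apply: le_trans (cell k t kltN _) _; first by rewrite (ltW kt).
  by rewrite lerD2r ler_wpM2l ?addr_ge0// IH// k0 lexx.
move=> t tT; apply: le_trans (YXW t tT) _; rewrite lerD2r.
apply: le_trans (WG N (leqnn N) t _) _; first by rewrite Ndt.
have -> : K * `|g| * mesh_osc L T N + T * (K * dt * CF + delta + K * (gam * c)) = \sum_(j < N) beta j.
  rewrite /beta -mulr_sumr big_split/= -mulr_sumr sumr_const card_ord -/rho /mesh_osc -/dt.
  by rewrite -[rho *+ N]mulr_natl -mulr_sumr -Ndt; rewrite /O; ring.
rewrite /G ler_wpM2r//; first by apply: sumr_ge0 => j _; exact: beta0.
apply: (@le_trans _ _ (expR (K * dt) ^+ N)).
  by rewrite lerXn2r ?nnegrE ?expR_ge0 ?addr_ge0// expR_ge1Dx.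
by rewrite -expRM_natl mulrCA -Ndt.
Qed.

End Paths.

(** * Choice of constants and convergence in probability *)

Unset Implicit Arguments.
Set Strict Implicit.

Theorem theorem2
  (R : realType) (d : nat) (alpha T : R) (x0 : 'rV[R]_d)
  (d0 : measure_display) (Omega : measurableType d0) (P : probability Omega R)
  (L : Omega -> R -> 'rV[R]_d)
  (f : 'rV[R]_d -> 'rV[R]_d) (g : R)
  (Y : Omega -> R -> 'rV[R]_d)
  (fm : nat -> 'rV[R]_d -> 'rV[R]_d) (gm : nat -> R)
  (X : nat -> R -> Omega -> R -> 'rV[R]_d) :
  (0 < d)%N -> 1 < alpha < 2 -> 0 < T ->
  (* L is a d-dim symmetric alpha-stable Levy motion (cadlag version) *)
  sym_stable_levy P alpha L ->
  (forall w, cadlag_on T (L w)) ->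
  (* f Lipschitz continuous *)
  (exists Kf : R, lipschitz_with Kf f) ->
  (* Y solves the SDE on [0,T] (pathwise) *)
  (forall w (i : 'I_d),
     (lebesgue_measure).-integrable `[0, T] (fun s => (f (Y w s) 0 i)%:E)) ->
  (forall w t, 0 <= t <= T -> forall i : 'I_d,
     (Y w t 0 i)%:E =
       ((x0 0 i)%:E + (\int[lebesgue_measure]_(s in `[0%R, t]) (f (Y w s) 0 i)%:E)
        + (g * L w t 0 i)%:E)%E) ->
  (* (i) uniform Lipschitz bound *)
  (exists K : R, 0 < K /\ forall m : nat, (0 < m)%N -> lipschitz_with K (fm m)) ->
  (* (ii) L^2(D) convergence on compacts and convergence of g_m *)
  (forall D : set 'rV[R]_d, compact D ->
     (fun m => L2dist2 D (fm m) f) @ \oo --> 0%E) ->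
  gm @ \oo --> g ->
  (* X^{(m,dt)} is the continuous-time Euler--Maruyama process *)
  (forall (m : nat) (dt : R), (0 < m)%N -> 0 < dt < 1 ->
     (exists N : nat, T = N%:R * dt) ->
     forall w t, 0 <= t <= T -> forall i : 'I_d,
       (X m dt w t 0 i)%:E =
         ((x0 0 i)%:E +
          (\int[lebesgue_measure]_(s in `[0%R, t])
              (fm m (X m dt w ((Num.floor (s / dt))%:~R * dt)) 0 i)%:E)
          + (gm m * L w t 0 i)%:E)%E) ->
  (* convergence in probability w.r.t. the Skorokhod distance d_T *)
  forall delta : R, 0 < delta ->
  forall eps : R, 0 < eps ->
  exists M : nat, exists h : R, 0 < h /\
    forall (m : nat) (dt : R), (M <= m)%N -> 0 < dt < 1 -> dt < h ->
      (exists N : nat, T = N%:R * dt) ->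
      (Pout P [set w | (delta%:E < skorokhod_dist T (Y w) (X m dt w))%E]
         < eps%:E)%E.
Proof.
move=> d0' _ T0 [mL _] cL [Kf fKf] iY YE [K [K0 fmK]] cvL2 cvg XE delta delta0 eps eps0.
have DR : 0 < d%:R :> R by rewrite ltr0n.
(* A common Lipschitz constant in the sup norm for [f] and all [fm m]; [Kf] may be negative, hence
   the absolute value. *)
pose K2 := (`|Kf| + K) * d%:R.
have K20 : 0 < K2 by rewrite mulr_gt0// ltr_wpDl.
have lip (h : 'rV[R]_d -> 'rV[R]_d) (k : R) : k <= `|Kf| + K -> lipschitz_with k h ->
    forall x y, `|h x - h y| <= K2 * `|x - y|.
  move=> kK hk; apply: lipschitz_norm => [|x y]; first by rewrite addr_ge0// ltW.
  by apply: le_trans (hk x y) _; rewrite ler_wpM2r// sqrtr_ge0.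
have fK x y : `|f x - f y| <= K2 * `|x - y|.
  by apply: lip fKf _ _; have := ler_norm Kf; lra.
have {}fmK m : (0 < m)%N -> forall x y, `|fm m x - fm m y| <= K2 * `|x - y|.
  by move=> m0; apply: lip (fmK m m0); rewrite lerDr.
clearbody K2.
pose A := expR (K2 * T); have A0 : 0 < A by exact: expR_gt0.
(* Gives the oscillation term at most [delta / 2]; [|g| + 1] avoids division by zero. *)
pose eta := delta / (2 * (d%:R * A * K2 * (`|g| + 1))).
have g1 : 0 < `|g| + 1 by rewrite ltr_wpDl.
have eta0 : 0 < eta by rewrite divr_gt0// !mulr_gt0.
have [n [c [B [mB PB Bc]]]] := path_control P T0 mL cL eta0 eps0.
have [Bd YBd] := solution_bounded g x0 T0 (ltW K20) (normr_ge0 c) fK.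
pose CF := `|f 0| + K2 * `|Bd|.
have CF0 : 0 <= CF by rewrite addr_ge0// mulr_ge0// ltW.
(* Once [dt], the error of [fm m] and that of [gm m] are all at most [kappa], the remaining terms
   are at most [kappa * Q]. *)
pose Q := A * T * (K2 * CF + 1 + K2 * `|c|) + `|c| + 1.
have AT0 : 0 < A * T by rewrite mulr_gt0.
have Q0 : 0 < Q.
  have := mulr_ge0 (ltW K20) CF0; have := mulr_ge0 (ltW K20) (normr_ge0 c) => h1 h2.
  rewrite ltr_wpDl// addr_ge0// mulr_ge0 ?(ltW AT0)//; lra.
pose kappa := delta / (2 * (d%:R * Q)).
have kappa0 : 0 < kappa by rewrite divr_gt0// !mulr_gt0.
have [M1 HM1] := L2_cvg_locally_uniform K20 fK fmK cvL2 `|Bd| kappa0.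
have /cvgr_dist_le /(_ _ kappa0) [M2 _ HM2] := cvg.
(* The [1] ensures [0 < m], and [dt < T / n.+1] forces at least [n] cells. *)
exists (maxn M1 (maxn M2 1)), (Num.min kappa (T / n.+1%:R)); split.
  by rewrite lt_min kappa0 divr_gt0.
move=> m dt; rewrite !geq_max => /and3P[M1m M2m m0] /[dup] dt01 /andP[dt0 dt1].
rewrite lt_min => /andP[dtk dtn] [N TE].
(* The outer probability is bounded through the measurable event [B], fixed before [m] and [dt]; off
   [B] the argument is deterministic. *)
apply: le_lt_trans PB; apply: ereal_inf_lbound; exists B => //; split => // w /= dist.
apply: contrapT => /Bc[Lc mesh]; move: dist; apply/negP; rewrite -leNgt.
have NR0 : 0 < N%:R :> R by rewrite -(pmulr_lgt0 _ dt0) -TE.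
have N0 : (0 < N)%N by rewrite ltr0n in NR0.
have dtE : dt = T / N%:R by rewrite TE mulrC mulKf ?gt_eqF.
have nN : (n <= N)%N.
  by move: dtn; rewrite dtE ltr_pM2l// ltf_pV2 ?posrE// ltr_nat => /ltnW/ltnW.
have {}Lc t : 0 <= t <= T -> `|L w t| <= `|c|.
  by move=> tT; apply: le_trans (Lc t tT) (ler_norm c).
have YB t : 0 <= t <= T -> `|Y w t| <= `|Bd|.
  move=> tT; apply: le_trans (ler_norm Bd).
  exact: (YBd (Y w) (L w) (iY w) (YE w) Lc).
have XE' := XE m dt m0 dt01 (ex_intro _ N TE) w.
apply: skorokhod_dist_le_uniform; first exact: ltW.
move=> t tT; apply: le_trans (enorm_le_norm _) _.
have gk : `|g - gm m| <= kappa by exact: HM2.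
have := @euler_error R d T K2 CF `|c| kappa kappa g (gm m) N x0 f (fm m) (Y w) (X m dt w) (L w)
  T0 (ltW K20) (ltW kappa0) N0 (cL w) fK (fmK m m0) (iY w) (YE w) _ Lc _ _ gk t tT.
rewrite -dtE => H.
have {H} : `|Y w t - X m dt w t| <= A * (K2 * `|g| * mesh_osc (L w) T N +
    T * (K2 * dt * CF + kappa + K2 * (kappa * `|c|))) + kappa * `|c|.
  apply: H => //.
    move=> s sT; have := fK (Y w s) 0; rewrite subr0.
    have := ler_wpM2l (ltW K20) (YB s sT).
    have := ler_normD (f (Y w s) - f 0) (f 0); rewrite subrK /CF; lra.
  by move=> s sT; apply: HM1 => //; exact: YB.
have h1 : d%:R * (A * (K2 * `|g| * mesh_osc (L w) T N)) <= delta / 2.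
  have e1 : d%:R * (A * (K2 * (`|g| + 1) * eta)) = delta / 2.
    by rewrite /eta; field; rewrite !gt_eqF.
  rewrite -e1 ler_pM2l// ler_pM2l// -!mulrA ler_pM2l//.
  apply: (@le_trans _ _ (`|g| * eta)); first by rewrite ler_wpM2l// mesh.
  by rewrite ler_pM2r// lerDl.
have h2 : d%:R * (A * (T * (K2 * dt * CF + kappa + K2 * (kappa * `|c|))) + kappa * `|c|) <= delta / 2.
  have e2 : d%:R * (kappa * Q) = delta / 2 by rewrite /kappa; field; rewrite !gt_eqF.
  rewrite -e2 ler_pM2l//.
  have h3 : K2 * dt * CF <= K2 * kappa * CF by rewrite ler_wpM2r// ler_pM2l// ltW.
  have := ler_wpM2l (ltW AT0) h3; rewrite /Q; lra.
move=> H; apply: le_trans (ler_wpM2l (ltW DR) H) _; lra.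
Qed.
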